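(* Let $T$ be a nonempty compact Hausdorff space, let $A \colon C(T) \to C(T)$ be a nonzero positive linear operator, let $b \in C(T)$ with $b \gg 0$, and let $s \in \mathbb{R}$ with $s \neq 0$. Let $G$ be the self-map on $\mathring{P}$ defined by $$Gy = \left( (Ay)^{1/s} + b \right)^s .$$ If $A$ is irreducible and eventually compact, then the following statements are equivalent: (i) $r(A)^s < 1$. (ii) $G$ is globally stable on $\mathring{P}$. Moreover, if $r(A)^s \geq 1$, then $G$ has no fixed point in $\mathring{P}$.
   Context: $C(T)$ is the Banach lattice of continuous real-valued functions on the compact Hausdorff space $T$, with the supremum norm and the pointwise partial order $\leq$. $P = \{x \in C(T) : x \geq 0\}$ is its positive cone and $\mathring{P}$ is the (norm) interior of $P$. For $x,y \in C(T)$, $x \ll y$ (equivalently $y \gg x$) means $y - x \in \mathring{P}$; in particular $b \gg 0$ means $b \in \mathring{P}$. Powers are taken pointwise: $x^s$ is the function $t \mapsto x(t)^s$. A linear operator $A \colon C(T) \to C(T)$ is positive if it maps $P$ into $P$. It is eventually compact if there is $k \in \mathbb{N}$ such that $A^k$ is compact (maps the unit ball to a relatively compact set). An ideal in $C(T)$ is a vector subspace $I \subset C(T)$ such that $g \in I$, $f \in C(T)$ and $|f| \leq |g|$ imply $f \in I$. A positive linear operator $A$ is irreducible if the only nontrivial (i.e. nonzero) closed ideal invariant under $A$ is the whole space $C(T)$. The spectral radius is $r(A) = \lim_{k\to\infty} \|A^k\|^{1/k}$, with $\|\cdot\|$ the operator norm. A self-map $G$ on a set $E \subset C(T)$ is globally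 stable on $E$ if $G$ has a unique fixed point $\bar{x}$ in $E$ and $\|G^k x - \bar{x}\| \to 0$ as $k \to \infty$ for every $x \in E$. *)

(* Defs.v *)
From HB Require Import structures.
From mathcomp Require Import all_boot all_order all_algebra.
From mathcomp Require Import all_classical all_reals all_analysis.
Set Implicit Arguments.
Unset Strict Implicit.
Unset Printing Implicit Defensive.
Import Order.TTheory GRing.Theory Num.Theory.
Import numFieldNormedType.Exports.
Local Open Scope classical_set_scope.
Local Open Scope ring_scope.

(* The compactness proof is a parameter of the type: it is what makes the
   supremum norm below a norm. *)
Definition cspace (R : realType) (T : topologicalType)
  (cT : compact [set: T]) : Type := continuousType T R.

Section CSpace.
Context {R : realType} {T : topologicalType} {cT : compact [set: T]}.
Local Notation C := (cspace R cT).
Implicit Types x y z : C.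

HB.instance Definition _ := gen_eqMixin C.
HB.instance Definition _ := gen_choiceMixin C.

Definition mkcspace (f : T -> R) (cf : continuous f) : C :=
  (mkcts cf : continuousType T R).

Lemma cspaceP x y : x = y <-> (x : T -> R) =1 y.
Proof. exact: continuousEP. Qed.

Lemma cspace_continuous x : continuous (x : T -> R).
Proof. exact: cts_fun. Qed.

Definition ccst (a : R) : C := mkcspace (@cst_continuous T R a).

Let zeroC : C := ccst 0.
Let addC x y : C := mkcspace (fun t =>
  cvgD (@cspace_continuous x t) (@cspace_continuous y t)).
Let oppC x : C := mkcspace (fun t => cvgN (@cspace_continuous x t)).
Let scaleC (a : R) x : C := mkcspace (fun t =>
  cvgM (@cvg_cst _ a _ (nbhs t) _) (@cspace_continuous x t)).

Let addCA : associative addC.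
Proof. by move=> x y z; apply/cspaceP => t; exact: addrA. Qed.
Let addCC : commutative addC.
Proof. by move=> x y; apply/cspaceP => t; exact: addrC. Qed.
Let add0C : left_id zeroC addC.
Proof. by move=> x; apply/cspaceP => t; exact: add0r. Qed.
Let addNC : left_inverse zeroC oppC addC.
Proof. by move=> x; apply/cspaceP => t; exact: addNr. Qed.
HB.instance Definition _ := GRing.isZmodule.Build C addCA addCC add0C addNC.

Let scaleCA a c x : scaleC a (scaleC c x) = scaleC (a * c) x.
Proof. by apply/cspaceP => t; exact: mulrA. Qed.
Let scale1C : left_id 1 scaleC.
Proof. by move=> x; apply/cspaceP => t; exact: mul1r. Qed.
Let scaleCDr : right_distributive scaleC +%R.
Proof. by move=> a x y; apply/cspaceP => t; exact: mulrDr. Qed.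
Let scaleCDl x : {morph scaleC^~ x : a c / a + c}.
Proof. by move=> a c; apply/cspaceP => t; exact: mulrDl. Qed.
HB.instance Definition _ := GRing.Zmodule_isLmodule.Build R C
  scaleCA scale1C scaleCDr scaleCDl.

Lemma cspace0E t : (0 : C) t = 0. Proof. by []. Qed.
Lemma cspaceDE x y t : (x + y) t = x t + y t. Proof. by []. Qed.
Lemma cspaceNE x t : (- x) t = - x t. Proof. by []. Qed.
Lemma cspaceBE x y t : (x - y) t = x t - y t. Proof. by []. Qed.
Lemma cspaceZE (a : R) x t : (a *: x) t = a * x t. Proof. by []. Qed.

Definition supnorm x : R := sup (range (fun t => `|x t|)).

Let bounded_cspace x : exists M, forall t, `|x t| <= M.
Proof.
have [[t0 _]|T0] := pselect ([set: T] !=set0); last first.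
  by exists 0 => t; exfalso; apply: T0; exists t.
have cx : {within [set: T], continuous (fun t => `|x t|)}.
  apply: continuous_subspaceT => t.
  by apply: cvg_norm; exact: cspace_continuous.
have [|c _ Hc] := @compact_EVT_max _ R _ [set: T] _ cT cx; first by exists t0.
by exists `|x c| => t; apply: Hc; rewrite inE.
Qed.

Lemma supnorm_ge x t : `|x t| <= supnorm x.
Proof.
have [M HM] := bounded_cspace x.
apply: ub_le_sup; last by exists t.
by exists M => _ [u _ <-].
Qed.

Lemma supnorm_ge0 x : 0 <= supnorm x.
Proof.
have [[t _]|T0] := pselect ([set: T] !=set0).
  exact: le_trans (supnorm_ge x t).
rewrite /supnorm [X in sup X](_ : _ = set0) ?sup0//.
by rewrite -subset0 => r [t _ _]; apply: T0; exists t.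
Qed.

Lemma supnorm_le x (M : R) : 0 <= M -> (forall t, `|x t| <= M) ->
  supnorm x <= M.
Proof.
move=> M0 HM; have [[t _]|T0] := pselect ([set: T] !=set0).
  apply: ge_sup; first by exists `|x t|; exists t.
  by move=> _ [u _ <-].
rewrite /supnorm [X in sup X](_ : _ = set0) ?sup0//.
by rewrite -subset0 => r [t _ _]; apply: T0; exists t.
Qed.

Let supnormD x y : supnorm (x + y) <= supnorm x + supnorm y.
Proof.
apply: supnorm_le => [|t]; first by rewrite addr_ge0// supnorm_ge0.
by rewrite (le_trans (ler_normD _ _))// lerD// supnorm_ge.
Qed.

Let supnormZ (a : R) x : supnorm (a *: x) = `|a| * supnorm x.
Proof.
have le_ (c : R) z : supnorm (c *: z) <= `|c| * supnorm z.
  apply: supnorm_le => [|t]; first by rewrite mulr_ge0// supnorm_ge0.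
  by rewrite cspaceZE normrM ler_wpM2l// supnorm_ge.
apply/eqP; rewrite eq_le le_/=.
have [->|a0] := eqVneq a 0; first by rewrite normr0 mul0r supnorm_ge0.
rewrite -ler_pdivlMl ?normr_gt0// -normfV.
by rewrite (le_trans _ (le_ _ _))// scalerA mulVf// scale1r.
Qed.

Let supnorm_eq0 x : supnorm x = 0 -> x = 0.
Proof.
move=> x0; apply/cspaceP => t; apply/eqP.
by rewrite -normr_le0 -x0 supnorm_ge.
Qed.

HB.instance Definition _ :=
  Lmodule_isNormed.Build R C supnormD supnormZ supnorm_eq0.

Lemma cspace_normE x : `|x| = sup (range (fun t => `|x t|)).
Proof. by []. Qed.

(* cle is <=, pcone is P, pint is its interior for the norm topology, and cll is
   the strong order x << y. *)
Definition cle x y : Prop := forall t, x t <= y t.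
Definition pcone : set C := [set x | cle 0 x].
Definition pint : set C := interior pcone.
Definition cll x y : Prop := pint (y - x).

Definition positive_op (A : C -> C) : Prop := set_fun pcone pcone A.

Definition is_ideal (I : set C) : Prop :=
  [/\ I 0, (forall (a : R) x y, I x -> I y -> I (a *: x + y)) &
      forall g f : C, I g -> (forall t, `|f t| <= `|g t|) -> I f].

Definition irreducible_op (A : C -> C) : Prop :=
  forall I : set C, is_ideal I -> closed I -> I `<=` A @^-1` I ->
    I <> [set 0] -> I = [set: C].

(* Pointwise power. For x >> 0 the function t |-> x(t)^p is continuous (lemma
   cpowE below), so the default value 0 is then not used. *)
Definition cpow x (p : R) : C :=
  match pselect (continuous (fun t => x t `^ p)) with
  | left cf => mkcspace cf
  | right _ => 0
  end.

(* Fixed-point map y |-> ((A y)^(1/s) + b)^s. Lemma Gmap_pint below shows that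
   it is a self-map of P° under the standing assumptions. *)
Definition Gmap (A : C -> C) (b : C) (s : R) (y : C) : C :=
  cpow (cpow (A y) s^-1 + b) s.

End CSpace.

Section NormedOperators.
Context {R : realType} {V : normedModType R}.

(* Real-valued, hence meaningful for bounded operators only; positive operators
   on C(T) are bounded, and then the limit in spectral_radius exists. *)
Definition opnorm (A : V -> V) : R :=
  sup [set `|A x| | x in [set x : V | `|x| <= 1]].

Definition spectral_radius (A : V -> V) : R :=
  limn (fun k : nat => opnorm (iter k A) `^ (k%:R^-1)).

Definition compact_op (A : V -> V) : Prop :=
  precompact (A @` [set x : V | `|x| <= 1]).

Definition eventually_compact (A : V -> V) : Prop :=
  exists k : nat, compact_op (iter k A).

Definition globally_stable (E : set V) (G : V -> V) : Prop :=
  set_fun E E G /\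
  exists xbar : V,
    [/\ E xbar /\ G xbar = xbar,
        forall x, E x -> G x = x -> x = xbar &
        forall x, E x ->
          (fun k : nat => `|iter k G x - xbar|) @ \oo --> (0 : R)].

End NormedOperators.

Section WellDefined.
Context {R : realType} {T : topologicalType} {cT : compact [set: T]}.
Local Notation C := (cspace R cT).
Implicit Types x y : C.

Lemma pint_ge x : pint x <-> exists2 e : R, 0 < e & forall t, e <= x t.
Proof.
split=> [/nbhs_normP[/= e e0 xe]|[e e0 xe]].
  exists (e / 2); first by rewrite divr_gt0.
  pose c : C := ccst (e / 2).
  suff xcP : pcone (x - c) by move=> t; move: (xcP t); rewrite cspaceBE subr_ge0.
  apply: xe => /=; rewrite opprB addrC subrK.
  apply: (@le_lt_trans _ _ (e / 2)).
    apply: supnorm_le => [|u]; first by rewrite divr_ge0// ltW.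
    by rewrite [c u]/= ger0_norm// divr_ge0// ltW.
  by rewrite ltr_pdivrMr// ltr_pMr// ltr1n.
suff : nbhs x pcone by [].
apply/(@nbhs_normP R C); exists e => //= y; rewrite /= => xy t.
rewrite cspace0E -(subKr (x t) (y t)) subr_ge0 (le_trans _ (xe t))//.
rewrite (le_trans (ler_norm _))// (le_trans (supnorm_ge (x - y) t))//.
exact: ltW.
Qed.

Lemma pint_gt0 x : pint x <-> forall t, 0 < x t.
Proof.
rewrite pint_ge; split=> [[e e0 xe] t|x0]; first exact: lt_le_trans (xe t).
have [[t0 _]|T0] := pselect ([set: T] !=set0); last first.
  by exists 1 => // t; exfalso; apply: T0; exists t.
have cx : {within [set: T], continuous (x : T -> R)}.
  exact: continuous_subspaceT (@cspace_continuous _ _ _ x).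
have [|c _ Hc] := @compact_EVT_min _ R _ [set: T] _ cT cx; first by exists t0.
by exists (x c) => // t; apply: Hc; rewrite inE.
Qed.

Lemma cpowE x (p : R) t : pint x -> cpow x p t = x t `^ p.
Proof.
move=> /pint_gt0 x0; rewrite /cpow; case: pselect => // -[] u.
apply: (@continuous_comp _ _ _ (x : T -> R) (fun a : R => a `^ p)).
  exact: cspace_continuous.
apply: differentiable_continuous; apply/derivable1_diffP.
by apply: derivable_powR; rewrite in_itv/= x0.
Qed.

Lemma cpow_pint x (p : R) : pint x -> pint (cpow x p).
Proof.
move=> xP; apply/pint_gt0 => t; rewrite cpowE// powR_gt0//.
by move/pint_gt0: xP.
Qed.

Lemma pintD x y : pint x -> pint y -> pint (x + y).
Proof.
move=> /pint_gt0 x0 /pint_gt0 y0; apply/pint_gt0 => t.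
by rewrite cspaceDE addr_gt0.
Qed.

Lemma irreducible_pint (A : {linear C -> C}) : hausdorff_space T ->
  (exists x, A x <> 0) -> positive_op A -> irreducible_op A ->
  set_fun pint pint A.
Proof.
move=> hT [x0 Ax0] Apos Airr y /[dup] /pint_gt0 y0 /pint_ge[e e0 ye].
have Ay0 t : 0 <= A y t.
  by apply: (Apos y) => u; rewrite cspace0E ltW.
apply/pint_gt0 => t; rewrite lt_neqAle Ay0 andbT eq_sym.
apply/negP => /eqP Ayt.
have dom x : forall u, `|x u| <= (`|x| / e *: y) u.
  move=> u; rewrite cspaceZE (le_trans (supnorm_ge x u))// mulrAC.
  by rewrite ler_pdivlMr// ler_wpM2l// supnorm_ge0.
have At x : A x t = 0.
  have h1 : 0 <= (A (`|x| / e *: y - x)) t.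
    apply: Apos => u; rewrite cspace0E cspaceBE subr_ge0.
    exact: le_trans (ler_norm _) (dom x u).
  have h2 : 0 <= (A (`|x| / e *: y + x)) t.
    apply: Apos => u; rewrite cspace0E cspaceDE -lerBlDr sub0r.
    by rewrite (le_trans _ (dom x u))// -normrN ler_norm.
  move: h1 h2; rewrite linearB linearD linearZ/=.
  rewrite cspaceBE cspaceDE cspaceZE Ayt mulr0 sub0r add0r oppr_ge0 => h1 h2.
  by apply/eqP; rewrite eq_le h1 h2.
pose I : set C := [set x | x t = 0].
have ideI : is_ideal I.
  split=> [//|a x z|g f]; rewrite /I/=.
    by rewrite cspaceDE cspaceZE => -> ->; rewrite mulr0 addr0.
  move=> g0 /(_ t); rewrite g0 normr0 normr_le0.
  by move/eqP.
have cloI : closed I.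
  move=> x Ix; apply/eqP; rewrite -normr_le0.
  apply/ler_addgt0Pr => d d0; rewrite add0r.
  have /Ix[z [Iz /= zx]] : nbhs x (ball x d) by exact: nbhsx_ballx.
  move: zx; rewrite -ball_normE/= => zx.
  rewrite -[x t]subr0 -Iz (le_trans (supnorm_ge (x - z) t))//.
  exact: ltW.
have invI : I `<=` A @^-1` I by move=> x _; exact: At.
have [I0|/eqP I0] := pselect (I = [set 0]); last first.
  have IT := Airr I ideI cloI invI (elimN eqP I0).
  have : I y by rewrite IT.
  by rewrite /I/= => yt; have := y0 t; rewrite yt ltxx.
apply: Ax0; apply/cspaceP => u; rewrite cspace0E.
suff -> : u = t by exact: At.
apply: contrapT => ut.
have /(@normal_completely_regular R) : normal_space T by exact: compact_normal.
move=> /(_ (hausdorff_accessible hT)) /(_ u [set t]).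
have ct : closed [set t].
  exact: (accessible_closed_set1 (hausdorff_accessible hT)).
move=> /(_ ct ut) /(@uniform_separatorP _ R)[f [cf _ fu ft]].
have fu0 : f u = 0 by apply: fu; exists u.
have ft1 : f t = 1 by apply: ft; exists t.
pose g : C := mkcspace cf - ccst 1.
have gE v : g v = f v - 1 by [].
have : I g by rewrite /I/= gE ft1 subrr.
rewrite I0 => /(congr1 (fun h : C => h u)); rewrite gE fu0 cspace0E sub0r.
by move/eqP; rewrite oppr_eq0 oner_eq0.
Qed.

Lemma GmapE (A : C -> C) (b : C) (s : R) y t :
  set_fun pint pint A -> pint b -> pint y ->
  Gmap A b s y t = ((A y t) `^ s^-1 + b t) `^ s.
Proof.
move=> AP bP yP; rewrite /Gmap cpowE; last first.
  by apply: pintD => //; apply: cpow_pint; exact: AP.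
by rewrite cspaceDE cpowE//; exact: AP.
Qed.

Lemma Gmap_pint (A : C -> C) (b : C) (s : R) :
  set_fun pint pint A -> pint b -> set_fun pint pint (Gmap A b s).
Proof.
move=> AP bP y yP; apply: cpow_pint; apply: pintD => //.
by apply: cpow_pint; exact: AP.
Qed.

End WellDefined.

(* Main.v *)
(* The substitution y = x^s turns G into x |-> H x + b with H x = (A x^s)^(1/s),
   which, whatever the sign of s, is monotone and positively homogeneous of
   degree one.  If H w <= rho w for some w >> 0 and rho < 1, then x |-> H x + b
   maps the order interval below M w into itself for all large M; since b
   dominates a fixed fraction of M w there, x <= (1 + a) y improves to
   (1 + a q^k) between the k-th iterates, with q < 1, and this gives a globally
   attracting fixed point.  Conversely a fixed point x = H x + b satisfies
   H x <= kappa x with kappa < 1, so y = x^s satisfies A y <= kappa^s y or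
   A y >= kappa^s y according to the sign of s; comparing with the growth of
   A^k 1 yields r(A)^s < 1.

   No eigenvector is needed: w comes from the strict inequality r(A)^s < 1.  If
   r(A) < l, a truncated Neumann series satisfies A w <= l w.  If l < r(A), the
   truncated sums z satisfy A z >= l z - l 1 and are unbounded; normalising them
   and applying a compact power of A gives in the limit v > 0 with A v >= l v,
   and irreducibility makes some partial sum of the A^k v strictly positive. *)
Require Import Defs.
From HB Require Import structures.
From mathcomp Require Import all_boot all_order all_algebra.
From mathcomp Require Import all_classical all_reals all_analysis.
From mathcomp Require Import ring lra.
Set Implicit Arguments.
Unset Strict Implicit.
Unset Printing Implicit Defensive.
Import Order.TTheory GRing.Theory Num.Theory.
Import numFieldNormedType.Exports.
Local Open Scope classical_set_scope.
Local Open Scope ring_scope.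

(** * Real powers, geometric growth and Fekete's lemma *)

Section Reals.
Context {R : realType}.
Implicit Types x y s l : R.

Lemma ler_powR_gt0 s x y : 0 < s -> 0 < x -> 0 < y ->
  (x `^ s <= y `^ s) = (x <= y).
Proof.
move=> s0 x0 y0; rewrite /powR !gt_eqF// ler_expR ler_pM2l//.
by rewrite ler_ln// posrE.
Qed.

Lemma ler_powR_lt0 s x y : s < 0 -> 0 < x -> 0 < y ->
  (x `^ s <= y `^ s) = (y <= x).
Proof.
move=> s0 x0 y0; rewrite /powR !gt_eqF// ler_expR ler_nM2l//.
by rewrite ler_ln// posrE.
Qed.

Lemma ltr_powR_gt0 s x y : 0 < s -> 0 < x -> 0 < y ->
  (x `^ s < y `^ s) = (x < y).
Proof. by move=> s0 x0 y0; rewrite !ltNge ler_powR_gt0. Qed.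

Lemma ltr_powR_lt0 s x y : s < 0 -> 0 < x -> 0 < y ->
  (x `^ s < y `^ s) = (y < x).
Proof. by move=> s0 x0 y0; rewrite !ltNge ler_powR_lt0. Qed.

Lemma powR_lt1_gt0 s x : 0 < s -> 0 < x -> (x `^ s < 1) = (x < 1).
Proof. by move=> s0 x0; rewrite -(ltr_powR_gt0 s0 x0 ltr01) powR1. Qed.

Lemma powR_lt1_lt0 s x : s < 0 -> 0 < x -> (x `^ s < 1) = (1 < x).
Proof. by move=> s0 x0; rewrite -(ltr_powR_lt0 s0 x0 ltr01) powR1. Qed.

Lemma powR_gt1_lt0 s x : s < 0 -> 0 < x -> (1 < x `^ s) = (x < 1).
Proof. by move=> s0 x0; rewrite -(ltr_powR_lt0 s0 ltr01 x0) powR1. Qed.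

Lemma powRK s x : s != 0 -> 0 <= x -> (x `^ s) `^ s^-1 = x.
Proof. by move=> s0 x0; rewrite -powRrM mulfV// powRr1. Qed.

Lemma expr_eventually_ge l x : 1 < l -> \forall n \near \oo, x <= l ^+ n.
Proof.
move=> l1; have l0 : 0 < l^-1 by rewrite invr_gt0; lra.
have [x0|x0] := leP x 0.
  by near=> n; rewrite (le_trans x0)// exprn_ge0//; lra.
have : `|l^-1| < 1 by rewrite gtr0_norm// invf_lt1//; lra.
move=> /cvg_expr /cvgrPdist_le /(_ x^-1); rewrite invr_gt0 => /(_ x0).
apply: filterS => n /=; rewrite sub0r normrN normrX gtr0_norm//.
by rewrite exprVn lef_pV2// posrE exprn_gt0//; lra.
Unshelve. all: by end_near. Qed.

Lemma cvg_powR_to1 (c : nat -> R) s : c @ \oo --> (1 : R) ->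
  (fun k => c k `^ s) @ \oo --> (1 : R).
Proof.
move=> c1; have h : {for 1, continuous (fun a : R => a `^ s)}.
  apply: differentiable_continuous; apply/derivable1_diffP.
  by apply: derivable_powR; rewrite in_itv/= ltr01.
by have := cvg_comp _ _ c1 h; rewrite powR1.
Qed.

(** Fekete's lemma. Division of [n] by a fixed [m.+1] gives [u n <= n%:R * v + K] with [v] close to
    the infimum of the quotients, which the linear lower bound makes finite. *)
Lemma subadditive_cvg (u : nat -> R) (c : R) :
  (forall m n, u (m + n)%N <= u m + u n) -> (forall n, c * n%:R <= u n) ->
  cvgn (fun n => u n / n%:R).
Proof.
move=> usub uc; pose V := [set u n.+1 / n.+1%:R | n in [set: nat]].
have hV : has_inf V.
  split; first by exists (u 1%N / 1%:R); exists 0%N.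
  by exists c => _ [n _ <-]; rewrite ler_pdivlMr.
apply/cvg_ex; exists (inf V); apply/cvgrPdist_le => e e0.
have [_ [m _ <-] vlt] := inf_adherent (divr_gt0 e0 (ltr0n R 2)) hV.
set v := u m.+1 / m.+1%:R in vlt.
(* [K] dominates [u j - j%:R * v] for all possible remainders [j] at once. *)
pose K := \sum_(j < m.+1) (`|u j| + j%:R * `|v|).
have K0 : 0 <= K by apply: sumr_ge0 => j _; rewrite addr_ge0// mulr_ge0.
have uq q j : u (q * m.+1 + j)%N <= q%:R * u m.+1 + u j.
  elim: q => [|q IH]; first by rewrite mul0n mul0r add0r.
  rewrite mulSn -addnA (le_trans (usub _ _))// -natr1; lra.
have uK n : u n <= n%:R * v + K.
  rewrite (divn_eq n m.+1) (le_trans (uq _ _))//.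
  have jm : (n %% m.+1 < m.+1)%N by rewrite ltn_mod.
  have : `|u (n %% m.+1)%N| + (n %% m.+1)%N%:R * `|v| <= K.
    rewrite /K (bigD1 (Ordinal jm))//= lerDl.
    by apply: sumr_ge0 => j _; rewrite addr_ge0// mulr_ge0.
  have -> : u m.+1 = m.+1%:R * v by rewrite /v mulrC divfK.
  rewrite natrD natrM mulrDl mulrA.
  have := ler_norm (u (n %% m.+1)%N).
  have : - ((n %% m.+1)%N%:R * `|v|) <= (n %% m.+1)%N%:R * v.
    by rewrite -mulrN ler_wpM2l// lerNl -normrN ler_norm.
  lra.
near=> n.
have n0 : (0 < n)%N by near: n; exact: nbhs_infty_gt.
have nR : 0 < n%:R :> R by rewrite ltr0n.
have lo : inf V <= u n / n%:R.
  apply: ge_inf; first exact: hV.2.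
  by exists n.-1 => //; rewrite prednK.
have hi : u n / n%:R <= v + e / 2.
  rewrite ler_pdivrMr// (le_trans (uK n))// mulrDl (mulrC v) lerD2l.
  rewrite -ler_pdivrMl ?divr_gt0//.
  by near: n; exact: nbhs_infty_ger.
by rewrite ler0_norm; lra.
Unshelve. all: by end_near. Qed.

End Reals.

(** * Order in C(T) and iterates of positive operators *)

Section Operators.
Context {R : realType} {T : topologicalType} {cT : compact [set: T]}.
Local Notation C := (cspace R cT).
Implicit Types (x y z : C) (a c e l : R) (A : {linear C -> C}).

Lemma ccstE a t : (ccst a : C) t = a.
Proof. by []. Qed.

Lemma cle_norm x : cle x (`|x| *: ccst 1).
Proof.
by move=> t; rewrite cspaceZE mulr1 (le_trans (ler_norm _))// supnorm_ge.
Qed.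

Lemma cle_pcone x y : cle x y <-> pcone (y - x).
Proof.
by split=> h t; have := h t; rewrite cspaceBE ?cspace0E subr_ge0.
Qed.

Lemma cle_norm_le x y : cle 0 x -> cle x y -> `|x| <= `|y|.
Proof.
move=> x0 xy; apply: supnorm_le => [|t]; first exact: supnorm_ge0.
rewrite ger0_norm; last exact: x0.
by rewrite (le_trans (xy t))// (le_trans (ler_norm _))// supnorm_ge.
Qed.

Lemma pint_cst c : 0 < c -> pint (ccst c : C).
Proof. by move=> c0; apply/pint_gt0. Qed.

Lemma pint_pcone x : pint x -> pcone x.
Proof. by move=> /pint_gt0 x0 t; exact/ltW/x0. Qed.

Lemma pint_le x y : pint x -> cle x y -> pint y.
Proof. by move=> /pint_gt0 x0 xy; apply/pint_gt0 => t;
  exact: lt_le_trans (xy t). Qed.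

Lemma pintZ c x : 0 < c -> pint x -> pint (c *: x).
Proof. by move=> c0 /pint_gt0 x0; apply/pint_gt0 => t; exact: mulr_gt0. Qed.

(** Interior points of the cone are order units, being bounded below by some [e > 0]. The added 1
    keeps the constant positive when [x = 0]. *)
Lemma pint_dom x y : pint y -> exists2 c, 0 < c & cle x (c *: y).
Proof.
move=> /pint_ge[e e0 ye]; exists (`|x| / e + 1) => [|t].
  by rewrite ltr_wpDl// divr_ge0// ltW.
rewrite cspaceZE mulrDl mul1r ler_wpDr//;
  first by rewrite (le_trans _ (ye t))// ltW.
rewrite (le_trans (ler_norm _))// (le_trans (supnorm_ge x t))// mulrAC.
by rewrite ler_pdivlMr// ler_wpM2l// supnorm_ge0.
Qed.

Lemma positive_le A : positive_op A -> {homo A : x y / cle x y}.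
Proof.
move=> Apos x y xy; apply: (cle_pcone _ _).2; rewrite -linearB.
by apply: Apos; exact: (cle_pcone _ _).1.
Qed.

(** Bundling an iterate as a linear map gives access to the generic linearity lemmas. *)
Lemma iter_linear A k : exists B : {linear C -> C}, iter k A = B :> (C -> C).
Proof.
elim: k => [|k [B EB]]; first by exists idfun.
by exists (A \o B); apply/funext => x /=; rewrite EB.
Qed.

Lemma iterZ A k c x : iter k A (c *: x) = c *: iter k A x.
Proof. by have [B ->] := iter_linear A k; rewrite linearZ. Qed.

Lemma iter_le A k : positive_op A -> {homo iter k A : x y / cle x y}.
Proof. by move=> Apos; elim: k => // k IH x y xy /=; apply/positive_le/IH. Qed.

Lemma iter_ge0 A k x : positive_op A -> cle 0 x -> cle 0 (iter k A x).
Proof.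
move=> Apos /(iter_le k Apos); have [B ->] := iter_linear A k.
by rewrite linear0.
Qed.

Lemma iter_supersol A c y k : positive_op A -> 0 <= c -> cle (A y) (c *: y) ->
  cle (iter k A y) (c ^+ k *: y).
Proof.
move=> Apos c0 Ay; elim: k => [|k IH]; first by rewrite expr0 scale1r.
move=> t; rewrite iterS (le_trans (positive_le Apos IH t))// linearZ exprSr
  -scalerA.
by rewrite !(cspaceZE (c ^+ k)) ler_wpM2l ?exprn_ge0//; exact: Ay.
Qed.

Lemma iter_subsol A c y k : positive_op A -> 0 <= c -> cle (c *: y) (A y) ->
  cle (c ^+ k *: y) (iter k A y).
Proof.
move=> Apos c0 Ay; elim: k => [|k IH]; first by rewrite expr0 scale1r.
move=> t; rewrite iterS (le_trans _ (positive_le Apos IH t))// linearZ exprSr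
  -scalerA.
by rewrite !(cspaceZE (c ^+ k)) ler_wpM2l ?exprn_ge0//; exact: Ay.
Qed.

(** * The spectral radius read off the growth of [iter k A (ccst 1)] *)

Section SpectralRadius.
Context (T0 : [set: T] !=set0) (A : {linear C -> C}).
Context (Apos : positive_op A) (Apint : set_fun pint pint A).

Lemma norm_iter_le k x : `|iter k A x| <= `|x| * `|iter k A (ccst 1)|.
Proof.
have H z t : (iter k A z) t <= `|z| * `|iter k A (ccst 1)|.
  have := iter_le k Apos (cle_norm z); rewrite iterZ => /(_ t) /le_trans; apply.
  rewrite cspaceZE ler_wpM2l//.
  by rewrite (le_trans (ler_norm _))// supnorm_ge.
apply: supnorm_le => [|t]; first exact: mulr_ge0.
rewrite ler_norml H andbT lerNl.
by have := H (- x) t; rewrite normrN -scaleN1r iterZ scaleN1r.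
Qed.

Lemma norm_cst1 : `|ccst 1 : C| = 1.
Proof.
have [t _] := T0; apply/eqP; rewrite eq_le; apply/andP; split.
  by apply: supnorm_le => // u; rewrite normr1.
by rewrite (le_trans _ (supnorm_ge _ t))//= normr1.
Qed.

(** The constant 1 is the largest element of the unit ball, so a positive operator attains its norm
    there. *)
Lemma opnorm_iter k : opnorm (iter k A) = `|iter k A (ccst 1)|.
Proof.
apply/eqP; rewrite eq_le; apply/andP; split.
  apply: ge_sup; first by exists `|iter k A (ccst 1)|, (ccst 1) => //=;
    rewrite norm_cst1.
  by move=> _ [x /= x1 <-]; rewrite (le_trans (norm_iter_le k x))// ler_piMl.
apply: ub_le_sup; last by exists (ccst 1) => //=; rewrite norm_cst1.
exists `|iter k A (ccst 1)| => _ [x /= x1 <-].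
by rewrite (le_trans (norm_iter_le k x))// ler_piMl.
Qed.

(** Strict positivity puts A 1 above a constant [e > 0], and this iterates. The logarithms of the
    norms thus get a linear lower bound. *)
Lemma norm_iter_ge : exists2 e, 0 < e & forall k, e ^+ k <= `|iter k A (ccst
  1)|.
Proof.
have /Apint/pint_ge[e e0 eA] := pint_cst (@ltr01 R).
exists e => // k; have [t _] := T0.
have /(iter_subsol k Apos (ltW e0))/(_ t) : cle (e *: ccst 1) (A (ccst 1)).
  by move=> u; rewrite cspaceZE mulr1.
rewrite cspaceZE mulr1 => /le_trans; apply.
by rewrite (le_trans (ler_norm _))// supnorm_ge.
Qed.

Lemma norm_iter_gt0 k : 0 < `|iter k A (ccst 1)|.
Proof.
have [e e0 eA] := norm_iter_ge.
by apply: lt_le_trans (eA k); exact: exprn_gt0.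
Qed.

(** The norms are submultiplicative, so Fekete's lemma applies to their logarithms; in particular
    the limit defining the spectral radius exists. *)
Lemma spectral_radius_lnE : exists2 L,
  spectral_radius A = expR L &
  (fun k => ln `|iter k A (ccst 1)| / k%:R) @ \oo --> L.
Proof.
have [e e0 eA] := norm_iter_ge.
have gt0 := norm_iter_gt0.
pose u k := ln `|iter k A (ccst 1)|.
have : cvgn (fun k => u k / k%:R).
  apply: (@subadditive_cvg _ _ (ln e)) => [m n|n].
    rewrite -lnM ?posrE// ler_ln ?posrE ?mulr_gt0//.
    by rewrite iterD (le_trans (norm_iter_le _ _))// mulrC.
  by rewrite mulr_natr -lnXn// ler_ln ?posrE ?exprn_gt0.
move=> /cvg_ex[L uL]; exists L => //.
apply: cvg_lim => //.
have -> : (fun k => opnorm (iter k A) `^ k%:R^-1) = (fun k => expR (u k /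
  k%:R)).
  by apply/funext => k; rewrite opnorm_iter /powR gt_eqF// mulrC.
by apply: continuous_cvg uL; exact: continuous_expR.
Qed.

Lemma spectral_radius_gt0 : 0 < spectral_radius A.
Proof. by have [L -> _] := spectral_radius_lnE; exact: expR_gt0. Qed.

Lemma norm_iter_ub l : spectral_radius A < l ->
  \forall k \near \oo, `|iter k A (ccst 1)| <= l ^+ k.
Proof.
have gt0 := norm_iter_gt0.
have [L -> uL] := spectral_radius_lnE => rl.
have l0 : 0 < l := lt_trans (expR_gt0 L) rl.
have Ll : L < ln l by rewrite -ltr_expR lnK.
near=> k; have k0 : (0 < k)%N by near: k; exact: nbhs_infty_gt.
have : ln `|iter k A (ccst 1)| / k%:R <= ln l.
  by near: k; exact: (cvgr_le _ uL).
by rewrite ler_pdivrMr ?ltr0n// mulr_natr -lnXn// ler_ln ?posrE ?exprn_gt0.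
Unshelve. all: by end_near. Qed.

Lemma norm_iter_lb l : 0 < l -> l < spectral_radius A ->
  \forall k \near \oo, l ^+ k <= `|iter k A (ccst 1)|.
Proof.
have gt0 := norm_iter_gt0.
have [L -> uL] := spectral_radius_lnE => l0 rl.
have Ll : ln l < L by rewrite -ltr_expR lnK.
near=> k; have k0 : (0 < k)%N by near: k; exact: nbhs_infty_gt.
have : ln l <= ln `|iter k A (ccst 1)| / k%:R.
  by near: k; exact: (cvgr_ge _ uL).
by rewrite ler_pdivlMr ?ltr0n// mulr_natr -lnXn// ler_ln ?posrE ?exprn_gt0.
Unshelve. all: by end_near. Qed.

(** Upper Collatz-Wielandt bound. If c < l < r(A), then l^k <= |A^k 1| <= M c^k |y| for all large k,
    although (l/c)^k is unbounded. *)
Lemma spectral_radius_le c y : 0 < c -> pint y -> cle (A y) (c *: y) ->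
  spectral_radius A <= c.
Proof.
move=> c0 yP Ay; rewrite leNgt; apply/negP => cr.
pose l := (c + spectral_radius A) / 2.
have cl : c < l by rewrite /l; lra.
have lr : l < spectral_radius A by rewrite /l; lra.
have l0 : 0 < l by lra.
have [M M0 My] := pint_dom (ccst 1) yP.
have := expr_eventually_ge (M * `|y| + 1); move=> /(_ (l / c)).
rewrite ltr_pdivlMr// mul1r => /(_ cl) H.
have [k [lk big]] := filter_ex (filterI (norm_iter_lb l0 lr) H).
have : `|iter k A (ccst 1)| <= M * (c ^+ k * `|y|).
  have -> : M * (c ^+ k * `|y|) = `|M *: (c ^+ k *: y)|.
    by rewrite !normrZ !ger0_norm// ?exprn_ge0// ltW.
  apply: cle_norm_le => [|t]; first by apply: iter_ge0 => // u; exact: ler01.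
  rewrite (le_trans (iter_le k Apos My t))// iterZ !(cspaceZE M) ler_pM2l//.
  exact: (iter_supersol k Apos (ltW c0) Ay).
have ck : 0 < c ^+ k by exact: exprn_gt0.
move: big; rewrite expr_div_n ler_pdivlMr//; lra.
Qed.

(** Lower Collatz-Wielandt bound. If r(A) < l < c, then at any point t one has c^k y(t) <= |y| l^k
    for all large k, although (c/l)^k is unbounded. *)
Lemma spectral_radius_ge c y : 0 < c -> pint y -> cle (c *: y) (A y) ->
  c <= spectral_radius A.
Proof.
move=> c0 yP Ay; rewrite leNgt; apply/negP => rc.
pose l := (c + spectral_radius A) / 2.
have r0 := spectral_radius_gt0.
have lc : l < c by rewrite /l; lra.
have rl : spectral_radius A < l by rewrite /l; lra.
have l0 : 0 < l by lra.
have [t _] := T0.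
have y0 : 0 < y t by move/pint_gt0: yP.
have := expr_eventually_ge (`|y| / y t + 1); move=> /(_ (c / l)).
rewrite ltr_pdivlMr// mul1r => /(_ lc) H.
have [k [lk big]] := filter_ex (filterI (norm_iter_ub rl) H).
have h1 : c ^+ k * y t <= `|y| * `|iter k A (ccst 1)|.
  apply: le_trans (norm_iter_le k y); apply: le_trans (supnorm_ge _ t).
  apply: le_trans (ler_norm _).
  exact: (iter_subsol k Apos (ltW c0) Ay t).
have lk0 : 0 < l ^+ k by exact: exprn_gt0.
have ny : 0 <= `|y| := normr_ge0 y.
have h2 := le_trans h1 (ler_wpM2l ny lk).
move: big; rewrite expr_div_n ler_pdivlMr// => big.
have := le_trans (ler_wpM2r (ltW y0) big) h2.
have -> : (`|y| / y t + 1) * l ^+ k * y t = `|y| * l ^+ k + l ^+ k * y t.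
  by field; rewrite gt_eqF.
by rewrite gerDl leNgt mulr_gt0.
Qed.

End SpectralRadius.
End Operators.

(** * Strictly positive sub- and supersolutions of [A w = l *: w] *)

Section SubSuperSolutions.
Context {R : realType} {T : topologicalType} {cT : compact [set: T]}.
Local Notation C := (cspace R cT).
Context (T0 : [set: T] !=set0) (A : {linear C -> C}).
Context (Apos : positive_op A).
Implicit Types (f g u v w x y : C) (c e l : R).

Lemma positive_norm_le f g :
  (forall t, `|f t| <= g t) -> forall t, `|A f t| <= A g t.
Proof.
move=> fg t; rewrite ler_norml lerNl; apply/andP; split.
  have : cle (- f) g by move=> u;
    rewrite (le_trans _ (fg u))// -normrN ler_norm.
  by move=> /(positive_le Apos)/(_ t); rewrite linearN.
have : cle f g by move=> u; rewrite (le_trans _ (fg u))// ler_norm.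
by move=> /(positive_le Apos)/(_ t).
Qed.

Lemma positive_norm_cst f t : `|A f t| <= `|f| * `|A (ccst 1)|.
Proof.
apply: le_trans (positive_norm_le (g := `|f| *: ccst 1) _ t) _ => [u|].
  by rewrite cspaceZE mulr1 supnorm_ge.
rewrite linearZ cspaceZE ler_wpM2l//.
by rewrite (le_trans (ler_norm _))// supnorm_ge.
Qed.

(** Truncated Neumann series of (I - A/l)^{-1} applied to the constant 1. *)
Definition neumann_sum l n : C := \sum_(k < n) l^-1 ^+ k *: iter k A (ccst 1).

Lemma neumann_sumS l n :
  neumann_sum l n.+1 = neumann_sum l n + l^-1 ^+ n *: iter n A (ccst 1).
Proof. by rewrite /neumann_sum big_ord_recr. Qed.

Lemma neumann_term_ge0 l n : 0 < l -> cle 0 (l^-1 ^+ n *: iter n A (ccst 1)).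
Proof.
move=> l0 t; rewrite cspaceZE mulr_ge0 ?exprn_ge0 ?invr_ge0 ?(ltW l0)//.
by apply: (iter_ge0 n Apos _ t) => u; exact: ler01.
Qed.

Lemma neumann_sum_ge0 l n : 0 < l -> cle 0 (neumann_sum l n).
Proof.
move=> l0; elim: n => [|n IH] t; first by rewrite /neumann_sum big_ord0.
by rewrite neumann_sumS cspaceDE addr_ge0//;
  [exact: IH|exact: (neumann_term_ge0 n l0 t)].
Qed.

Lemma neumann_sum_ge_last l n : 0 < l ->
  cle (l^-1 ^+ n *: iter n A (ccst 1)) (neumann_sum l n.+1).
Proof.
by move=> l0 t; rewrite neumann_sumS cspaceDE lerDr;
  exact: (neumann_sum_ge0 n l0 t).
Qed.

Lemma neumann_sum_pint l n : 0 < l -> pint (neumann_sum l n.+1).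
Proof.
move=> l0; apply: (pint_le (pint_cst ltr01)); elim: n => [|n IH] t.
  by rewrite /neumann_sum big_ord1 expr0 scale1r.
rewrite neumann_sumS cspaceDE (le_trans (IH t))// lerDl.
exact: (neumann_term_ge0 n.+1 l0 t).
Qed.

(** Telescoping: [A] shifts the series by one index, so the constant 1 leaves and the term of index
    [n] enters. *)
Lemma apply_neumann_sum l n : 0 < l ->
  A (neumann_sum l n) =
  l *: (neumann_sum l n - ccst 1 + l^-1 ^+ n *: iter n A (ccst 1)).
Proof.
move=> l0; elim: n => [|n IH].
  by rewrite /neumann_sum big_ord0 linear0 expr0 scale1r sub0r addNr scaler0.
rewrite neumann_sumS linearD IH linearZ; apply/cspaceP => t.
rewrite !(cspaceDE, cspaceZE, cspaceNE) -iterS exprS.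
by field; rewrite gt_eqF.
Qed.

(** Once |A^n 1| <= l^n, the term entering the Neumann sum is at most the constant 1 that leaves
    it. *)
Lemma supersolution l : set_fun pint pint A -> spectral_radius A < l ->
  exists2 w, pint w & cle (A w) (l *: w).
Proof.
move=> Apint rl; have l0 := lt_trans (spectral_radius_gt0 T0 Apos Apint) rl.
have [n [n0 An]] := filter_ex
  (filterI (nbhs_infty_gt 0) (norm_iter_ub T0 Apos Apint rl)).
exists (neumann_sum l n); first by rewrite -(prednK n0);
  exact: neumann_sum_pint.
move=> t; rewrite apply_neumann_sum// !(cspaceDE, cspaceZE, cspaceNE).
rewrite ler_pM2l// -addrA gerDl addrC subr_le0 exprVn ler_pdivrMl ?exprn_gt0//.
by rewrite mulr1 (le_trans (ler_norm _))// (le_trans (supnorm_ge _ t)).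
Qed.

(** The last term suffices: for l < l' < r(A) its norm is eventually at least (l'/l)^k. *)
Lemma neumann_sum_unbounded l M : set_fun pint pint A ->
  0 < l -> l < spectral_radius A ->
  \forall k \near \oo, M <= `|neumann_sum l k.+1|.
Proof.
move=> Apint l0 lr; pose l' := (l + spectral_radius A) / 2.
have ll' : l < l' by rewrite /l'; lra.
have l'r : l' < spectral_radius A by rewrite /l'; lra.
have := @expr_eventually_ge _ (l' / l) M;
  rewrite ltr_pdivlMr// mul1r => /(_ ll').
apply: filterS2 (norm_iter_lb T0 Apos Apint (lt_trans l0 ll') l'r) => k ak Mk.
apply: le_trans Mk _.
apply: le_trans (cle_norm_le (neumann_term_ge0 k l0) (neumann_sum_ge_last k
  l0)).
rewrite normrZ ger0_norm ?exprn_ge0 ?invr_ge0 ?(ltW l0)// expr_div_n mulrC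
  exprVn.
by rewrite ler_wpM2l// invr_ge0 exprn_ge0// ltW.
Qed.

(** The constant [c] is chosen before [e] and [u], so the defect after [j] applications of [A]
    vanishes with [e], uniformly in [u]. *)
Lemma iter_approx_subsol l j : 0 < l -> exists2 c, 0 <= c & forall e u,
  0 <= e -> cle (l *: u - e *: ccst 1) (A u) ->
  cle (l ^+ j *: u - (e * c) *: ccst 1) (iter j A u).
Proof.
move=> l0; elim: j => [|j [c c0 IH]].
  by exists 0 => // e u _ _ t; rewrite expr0 scale1r mulr0 scale0r subr0.
(* The first summand is the defect of [u] scaled by [l ^+ j]; the second is the previous defect
   after one more application of [A]. *)
exists (l ^+ j + c * `|A (ccst 1)|) => [|e u e0 Au t].
  by rewrite addr_ge0 ?mulr_ge0 ?exprn_ge0// ltW.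
rewrite iterS (le_trans _ (positive_le Apos (IH e u e0 Au) t))//.
rewrite linearB !linearZ.
have := Au t; rewrite !(cspaceDE, cspaceZE, cspaceNE) !mulr1 => Aut.
have lj : 0 <= l ^+ j by rewrite exprn_ge0// ltW.
have h1 := ler_wpM2l lj Aut.
have h2 : A (ccst 1) t <= `|A (ccst 1)| by rewrite (le_trans (ler_norm _))//
  supnorm_ge.
have h3 := ler_wpM2l (mulr_ge0 e0 c0) h2.
by rewrite exprS ccstE; lra.
Qed.

Lemma weak_subsolution l : set_fun pint pint A -> eventually_compact A ->
  0 < l -> l < spectral_radius A ->
  exists v, [/\ cle 0 v, v <> 0 & cle (l *: v) (A v)].
Proof.
move=> Apint [m Acpt] l0 lr.
pose z k := neumann_sum l k.+1.
pose u k := `|z k|^-1 *: z k; pose v k := iter m A (u k).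
have zgt0 k : 0 < `|z k|.
  have [t _] := T0; apply: lt_le_trans (supnorm_ge _ t).
  by rewrite normr_gt0 gt_eqF//; move: t; apply/pint_gt0/neumann_sum_pint.
have u1 k : `|u k| = 1.
  by rewrite normrZ ger0_norm ?invr_ge0// mulVf// gt_eqF.
have u0 k : cle 0 (u k).
  by move=> t; rewrite cspaceZE mulr_ge0 ?invr_ge0//;
    exact: (neumann_sum_ge0 _ l0 t).
have v0 k : cle 0 (v k) by exact: iter_ge0.
(* The nonnegative entering term is dropped; normalisation divides the remaining defect [l] by the
   norm of [z k]. *)
have Au k : cle (l *: u k - (l / `|z k|) *: ccst 1) (A (u k)).
  have Az : A (z k) = _ := apply_neumann_sum k.+1 l0.
  have Auz : A (u k) = `|z k|^-1 *: A (z k) by exact: linearZ.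
  move=> t; rewrite Auz Az.
  have := neumann_term_ge0 k.+1 l0 t.
  rewrite !(cspaceDE, cspaceZE, cspaceNE) -/(z k) !ccstE.
  set q := _ * _ => q0.
  have : 0 <= `|z k|^-1 * l * q by apply: mulr_ge0 q0;
    rewrite mulr_ge0 ?invr_ge0 ?(ltW l0).
  by lra.
have Av k : cle (l *: v k - (l / `|z k|) *: iter m A (ccst 1)) (A (v k)).
  have [B EB] := iter_linear A m.
  have AB x : B (A x) = A (B x) by rewrite -EB -iterSr iterS.
  have := iter_le m Apos (Au k); rewrite /v EB AB.
  have BZB a d x y : B (a *: x - d *: y) = a *: B x - d *: B y.
    by rewrite linearB !linearZ.
  by rewrite BZB.
have [c c0 vu] := iter_approx_subsol m l0.
have small e : 0 < e -> \forall k \near \oo, l / `|z k| <= e.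
  move=> e0; apply: filterS (neumann_sum_unbounded (l / e) Apint l0 lr) => k.
  by rewrite ler_pdivrMr// ler_pdivrMr// mulrC.
have vcl k : closure (iter m A @` [set x : C | `|x| <= 1]) (v k).
  by apply: subset_closure; exists (u k) => //=; rewrite u1.
have vball : (v @ \oo) (closure (iter m A @` [set x : C | `|x| <= 1])).
  by exists 0%N => // k _; exact: vcl.
have := Acpt; rewrite /compact_op precompactE => /(_ (v @ \oo) _ vball)[w [_
  wcl]].
(* The cluster point [w] is used without a subsequence: every eventual property holds at some index
   [k] with [v k] within [e] of [w]. *)
have wv e (P : set nat) : 0 < e -> (\forall k \near \oo, P k) ->
    exists2 k, P k & forall t, `|w t - v k t| <= e.
  move=> e0 PP; have [] := wcl (v @` P) (ball w e).
  - by apply: filterS PP => k Pk; exists k.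
  - exact: nbhsx_ballx.
  move=> _ [[k Pk <-]]; rewrite -ball_normE/= => wvk; exists k => // t.
  by rewrite (le_trans (supnorm_ge (w - v k) t))// ltW.
have lm : 0 < l ^+ m by exact: exprn_gt0.
exists w; split.
- move=> t; rewrite cspace0E; apply/ler_addgt0Pr => e e0.
  have [k _ /(_ t)] := wv e setT e0 filterT.
  have := v0 k t; rewrite cspace0E ler_norml => + /andP[].
  by lra.
(* If [w = 0], some [v k] has values at most l^m/4; this [e] bounds the defect by l^m/4 as well.
   Then l^m u_k has norm at most l^m/2, against |u_k| = 1. *)
- move=> w0; pose e := l ^+ m / (4 * (c + 1)).
  have e0 : 0 < e by rewrite divr_gt0// mulr_gt0// ltr_wpDl.
  have lm4 : 0 < l ^+ m / 4 by rewrite divr_gt0.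
  have [k ke wk] := wv _ _ lm4 (small e e0).
  have ec : e * c <= l ^+ m / 4.
    have c1 : 0 < c + 1 by rewrite ltr_wpDl.
    have -> : e * c = l ^+ m / 4 * (c / (c + 1)) by rewrite /e; field;
      rewrite gt_eqF.
    by rewrite ler_piMr ?(ltW lm4)// ler_pdivrMr// mul1r lerDl.
  suff : `|l ^+ m *: u k| <= l ^+ m / 2.
    by rewrite normrZ u1 mulr1 (ger0_norm (ltW lm)); move: lm; lra.
  apply: supnorm_le => [|t]; first by rewrite divr_ge0// ltW.
  have uk0 : 0 <= l ^+ m * u k t by rewrite mulr_ge0 ?(u0 k t)// ltW.
  rewrite cspaceZE ger0_norm//.
  have := vu (l / `|z k|) (u k) (divr_ge0 (ltW l0) (ltW (zgt0 k))) (Au k) t.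
  rewrite !(cspaceDE, cspaceZE, cspaceNE) ccstE mulr1 -/(v k).
  have := wk t; rewrite w0 cspace0E sub0r normrN => /(le_trans (ler_norm _)).
  have := ler_wpM2r c0 ke.
  by lra.
move=> t; rewrite cspaceZE; apply/ler_addgt0Pr => e e0.
(* [K] adds the coefficients of three errors: [v k] replaced by [w] under [A], the defect of [v k],
   and [v k] replaced by [w] in the multiple by [l]. *)
pose K := `|A (ccst 1)| + `|iter m A (ccst 1)| + l.
have K0 : 0 < K by rewrite ltr_wpDl// addr_ge0.
have d0 : 0 < e / K by exact: divr_gt0.
have [k ke wk] := wv _ _ d0 (small _ d0).
have h1 : - (e / K * `|A (ccst 1)|) <= A w t - A (v k) t.
  have nw : `|w - v k| <= e / K by apply: supnorm_le; rewrite ?ltW.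
  have := positive_norm_cst (w - v k) t; rewrite linearB cspaceBE.
  move=> /le_trans/(_ (ler_wpM2r (normr_ge0 _) nw)).
  by rewrite ler_norml => /andP[].
have h2 := Av k t; rewrite !(cspaceDE, cspaceZE, cspaceNE) in h2.
have h3 : l / `|z k| * iter m A (ccst 1) t <= e / K * `|iter m A (ccst 1)|.
  apply: ler_pM => //; first by rewrite divr_ge0 ?ltW.
    by apply: (iter_ge0 m Apos _ t) => x; exact: ler01.
  by rewrite (le_trans (ler_norm _))// supnorm_ge.
have h4 : l * (w t - v k t) <= e / K * l.
  by rewrite mulrC ler_pM2r// (le_trans (ler_norm _)).
have : e = e / K * `|A (ccst 1)| + e / K * `|iter m A (ccst 1)| + e / K * l.
  by rewrite -!mulrDr divfK// gt_eqF.
by lra.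
Qed.

(** Partial orbit sums of [v] are again subsolutions, and the closed ideal they generate is
    invariant and nonzero. It therefore contains the constant 1, which forces one of the sums to
    have no zero. *)
Lemma irreducible_subsolution v l : irreducible_op A -> 0 < l ->
  cle 0 v -> v <> 0 -> cle (l *: v) (A v) ->
  exists2 w, pint w & cle (l *: w) (A w).
Proof.
move=> Airr l0 v0 vn0 Av; pose S n := \sum_(k < n) iter k A v.
have SS n : S n.+1 = S n + iter n A v by rewrite /S big_ord_recr.
have SA n : A (S n) + v = S n.+1.
  elim: n => [|n IH]; first by rewrite /S big_ord0 linear0 big_ord1 add0r.
  by rewrite SS linearD addrAC IH -iterS -SS.
have S_le n m : cle (S n) (S (n + m)%N).
  elim: m => [|m IH] t; first by rewrite addn0.
  rewrite addnS SS cspaceDE (le_trans (IH t))// lerDl.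
  exact: (iter_ge0 (n + m) Apos v0 t).
have S0 n : cle 0 (S n).
  by move=> t; have := S_le 0%N n t; rewrite add0n {1}/S big_ord0.
have Ssub n : cle (l *: S n) (A (S n)).
  elim: n => [|n IH] t; first by rewrite /S big_ord0 linear0 scaler0.
  rewrite SS linearD scalerDr !(cspaceDE _ _ t) lerD//.
  have := iter_le n Apos Av; rewrite iterZ -iterSr iterS.
  by move/(_ t).
(* The closed ideal generated by the orbit of [v], described by uniform
   approximation so that no closure has to be taken. *)
pose I : set C := [set f | forall e, 0 < e ->
  exists n, exists2 c, 0 <= c & forall t, `|f t| <= c * S n t + e].
have IT : I = setT.
  apply: Airr.
  - split.
    + by move=> e e0; exists 0%N, 0 => // t;
        rewrite cspace0E normr0 mul0r add0r ltW.
    + move=> a x y Ix Iy e e0.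
      pose d := e / 2 / (`|a| + 1).
      have d0 : 0 < d by rewrite !divr_gt0// ltr_wpDl.
      have [n [c c0 xc]] := Ix d d0.
      have [m [c' c'0 yc]] := Iy _ (divr_gt0 e0 (ltr0n R 2)).
      exists (n + m)%N, (`|a| * c + c') => [|t];
        first by rewrite addr_ge0// mulr_ge0.
      rewrite cspaceDE cspaceZE (le_trans (ler_normD _ _))// normrM.
      have h1 := ler_wpM2l (normr_ge0 a) (xc t).
      have h2 := ler_wpM2l (mulr_ge0 (normr_ge0 a) c0) (S_le n m t).
      have := S_le m n t; rewrite addnC => /(ler_wpM2l c'0) h3.
      have h4 : `|a| * d <= e / 2.
        rewrite /d mulrCA ler_piMr ?divr_ge0 ?ltW//.
        by rewrite ltr_pdivrMr ?mul1r ?ltrDl// ltr_wpDl.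
      by have := yc t; lra.
    + move=> g f Ig fg e /Ig[n [c c0 gc]]; exists n, c => // t.
      exact: le_trans (fg t) (gc t).
  - move=> f If e e0; have e2 : 0 < e / 2 by rewrite divr_gt0.
    have /If[g [Ig]] : nbhs f (ball f (e / 2)) by exact: nbhsx_ballx.
    rewrite -ball_normE/= => fg; have [n [c c0 gc]] := Ig _ e2.
    exists n, c => // t; rewrite -[f t](subrK (g t)).
    rewrite (le_trans (ler_normD _ _))//.
    have := le_lt_trans (supnorm_ge (f - g) t) fg; rewrite cspaceBE.
    by have := gc t; lra.
  (* Invariance follows from [A (S n) <= S n.+1]; [d] is small enough for the image under [A] of the
     constant error to stay below [e]. *)
  - move=> f If e e0; pose d := e / (`|A (ccst 1)| + 1).
    have d0 : 0 < d by rewrite divr_gt0// ltr_wpDl.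
    have [n [c c0 fc]] := If d d0; exists n.+1, c => // t.
    apply: le_trans (positive_norm_le (g := c *: S n + d *: ccst 1) _ t) _ =>
      [u|].
      by rewrite cspaceDE !cspaceZE ccstE mulr1.
    rewrite linearD !linearZ cspaceDE !cspaceZE lerD//.
      by rewrite ler_wpM2l// -SA cspaceDE lerDl; exact: (v0 t).
    rewrite /d -mulrAC ler_pdivrMr ?ltr_wpDl// ler_pM2l//.
    by rewrite ler_wpDr// (le_trans (ler_norm _))// supnorm_ge.
  - move=> I0; apply: vn0.
    have : I v.
      move=> e e0; exists 1%N, 1 => // t; rewrite /S big_ord1 mul1r.
      by rewrite (ger0_norm (v0 t)) lerDl ltW.
    by rewrite I0.
have : I (ccst 1) by rewrite IT.
(* With tolerance 1/2, a zero of [S n] would give 1 <= 1/2. *)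
move=> /(_ _ (divr_gt0 ltr01 (ltr0n R 2)))[n [c c0 Sc]].
exists (S n) => //; apply/pint_gt0 => t; rewrite lt_neqAle; apply/andP; split;
  last exact: (S0 n t).
by apply/eqP => S0t; have := Sc t; rewrite -S0t mulr0 add0r normr1; lra.
Qed.

Lemma subsolution l : set_fun pint pint A -> irreducible_op A ->
  eventually_compact A -> 0 < l -> l < spectral_radius A ->
  exists2 w, pint w & cle (l *: w) (A w).
Proof.
move=> Apint Airr Acpt l0 lr.
have [v [v0 vn0 Av]] := weak_subsolution Apint Acpt l0 lr.
exact: irreducible_subsolution Av.
Qed.

End SubSuperSolutions.

(** * Monotone maps that contract order ratios *)

Section MonotoneContraction.
Context {R : realType} {T : topologicalType} {cT : compact [set: T]}.
Local Notation C := (cspace R cT).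
Implicit Types (x y w : C) (c : R).

Lemma uniform_approx_continuous (f : T -> R) :
  (forall e, 0 < e -> exists x : C, forall t, `|f t - x t| <= e) ->
  continuous f.
Proof.
move=> fx t; apply/cvgrPdist_le => e e0.
have e3 : 0 < e / 3 by rewrite divr_gt0.
have [x fxe] := fx _ e3.
have /cvgrPdist_le/(_ _ e3) := @cspace_continuous _ _ _ x t.
apply: filterS => u xtu.
rewrite (_ : f t - f u = (f t - x t) + (x t - x u) - (f u - x u)); last by ring.
rewrite (le_trans (ler_normB _ _))//.
have := ler_normD (f t - x t) (x t - x u).
by have := fxe t; have := fxe u; move: xtu; lra.
Qed.

Lemma cvg_geometric_to1 (a q : R) : 0 <= q -> q < 1 ->
  (fun k => 1 + a * q ^+ k) @ \oo --> (1 : R).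
Proof.
move=> q0 q1; rewrite -[X in _ --> X]addr0 -[X in _ + X](mulr0 a).
by apply: cvgD; [exact: cvg_cst|apply: cvgMr; apply: cvg_expr;
  rewrite ger0_norm].
Qed.

Context (F : C -> C) (b w : C) (M0 : R).
Context (Fpint : set_fun pint pint F) (bP : pint b) (wP : pint w).
Context (Fmono : forall x y, pint x -> pint y -> cle x y -> cle (F x) (F y)).
Context (Fb : forall x, pint x -> cle b (F x)).
(** For [F x = H x + b] with [H] homogeneous of degree one this is an equality; the gain
    [(c - 1) *: b] drives the contraction. *)
Context (FZ : forall c x, 1 <= c -> pint x ->
  cle (F (c *: x)) (c *: F x - (c - 1) *: b)).
Context (M0_gt0 : 0 < M0).
Context (Fw : forall M, M0 <= M -> cle (F (M *: w)) (M *: w)).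

Lemma iter_pint k x : pint x -> pint (iter k F x).
Proof. by move=> xP; elim: k => // k IH; exact: Fpint. Qed.

Lemma iter_le_bound M y k : M0 <= M -> pint y -> cle y (M *: w) ->
  cle (iter k F y) (M *: w).
Proof.
move=> M0M yP yM; elim: k => // k IH t.
apply: le_trans (Fw M0M t); apply: Fmono => //; first exact: iter_pint.
by apply: pintZ => //; exact: lt_le_trans M0M.
Qed.

(** The iterates of [y] stay below [M *: w], hence below a multiple of [b]. The gain in [FZ] is thus
    a fixed fraction of the excess ratio at every step. *)
Lemma iter_contraction M : M0 <= M -> exists2 q, 0 <= q < 1 &
  forall a x y, 0 <= a -> pint x -> pint y -> cle y (M *: w) ->
    cle x ((1 + a) *: y) ->
  forall k, cle (iter k F x) ((1 + a * q ^+ k) *: iter k F y).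
Proof.
move=> M0M; have [D D0 wD] := pint_dom (M *: w) bP.
have D1 : 0 < D + 1 by rewrite ltr_wpDl// ltW.
(* Using [D + 1] in place of [D] keeps the factor nonnegative when [D < 1]. *)
exists (1 - (D + 1)^-1) => [|a x y a0 xP yP yM xy k].
  rewrite subr_ge0 invf_le1// lerDr (ltW D0)/=.
  by rewrite ltrBlDr ltrDl invr_gt0.
set q := 1 - _; have q0 : 0 <= q by rewrite subr_ge0 invf_le1// lerDr ltW.
elim: k => [|k IH] t; first by rewrite expr0 mulr1.
have aq : 0 <= a * q ^+ k by rewrite mulr_ge0// exprn_ge0.
have c1 : 1 <= 1 + a * q ^+ k by rewrite lerDl.
have c0 : 0 < 1 + a * q ^+ k by rewrite ltr_pwDl.
have := Fmono (iter_pint k xP) (pintZ c0 (iter_pint k yP)) IH t.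
move=> /le_trans; apply.
apply: le_trans (FZ c1 (iter_pint k yP) t) _.
rewrite !(cspaceDE, cspaceZE, cspaceNE).
have : (D + 1)^-1 * iter k.+1 F y t <= b t.
  rewrite ler_pdivrMl//.
  have := iter_le_bound k.+1 M0M yP yM t; have := wD t; rewrite !cspaceZE.
  have : 0 < b t by move: t; apply/pint_gt0.
  by lra.
move=> /(ler_wpM2l aq); rewrite exprSr /q iterS.
by set z := F _ t; set p := q ^+ k; lra.
Qed.

(** The orbit of the supersolution [M0 *: w] decreases. The ratio estimate makes its convergence to
    the pointwise infimum uniform, so the infimum is continuous. *)
Lemma exists_fixed_point : exists2 x, pint x & F x = x.
Proof.
pose z : C := M0 *: w; have zP : pint z by exact: pintZ.
have [q /andP[q0 q1] contr] := iter_contraction (lexx M0).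
pose x k := iter k F z.
have xP k : pint (x k) by exact: iter_pint.
have xS k : cle (x k.+1) (x k).
  by elim: k => [|k IH]; [exact: Fw|exact: (Fmono (xP k.+1) (xP k) IH)].
have xD k j : cle (x (k + j)%N) (x j).
  by elim: k => // k IH t; rewrite addSn (le_trans (xS _ t))//; exact: IH.
(* All iterates after the first term lie above [b], so one ratio [1 + a] compares [z] with every
   [x j]; the 1 covers [j = 0]. *)
have [a a0 za] := pint_dom z bP.
have za1 j : cle z ((1 + a) *: x j).
  move=> t; case: j => [|j].
    rewrite (cspaceZE (1 + a)) mulrDl mul1r lerDl mulr_ge0 ?(ltW a0)//.
    exact: (pint_pcone zP t).
  rewrite (le_trans (za t))// !cspaceZE.
  have := Fb (xP j) t; rewrite -[F _]/(x j.+1).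
  have : 0 < b t by move: t; apply/pint_gt0.
  by move=> b0 bx; apply: ler_pM bx; rewrite ?(ltW a0) ?(ltW b0)// lerDr.
(* The contraction compares the orbits of [z] and [x j], and the k-th iterate of [x j] is
   [x (k + j)], which lies below [x j]. *)
have xx k j : cle (x k) ((1 + a * q ^+ k) *: x j).
  move=> t; have := contr a z (x j) (ltW a0) zP (xP j).
  move=> /(_ (iter_le_bound j (lexx _) zP (fun=> lexx _)) (za1 j) k t).
  move=> /le_trans; apply; rewrite !cspaceZE -iterD ler_pM2l; first exact: xD.
  by rewrite ltr_pwDl// mulr_ge0 ?(ltW a0)// exprn_ge0.
have aq k : 0 <= a * q ^+ k by rewrite mulr_ge0 ?(ltW a0)// exprn_ge0.
have aq1 k : 0 < 1 + a * q ^+ k by rewrite ltr_pwDl.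
pose f t := inf (range (fun k => x k t)).
have hasinf t : has_inf (range (fun k => x k t)).
  split; first by exists (x 0%N t), 0%N.
  by exists 0 => _ [k _ <-]; exact: (pint_pcone (xP k) t).
have fx k t : f t <= x k t by apply: ge_inf; [exact: (hasinf t).2|exists k].
have xf k t : x k t <= (1 + a * q ^+ k) * f t.
  rewrite -ler_pdivrMl//; apply: lb_le_inf; first exact: (hasinf t).1.
  by move=> _ [j _ <-]; rewrite ler_pdivrMl//; exact: xx.
have f0 t : 0 < f t.
  have : 0 < x 0%N t by move: t; apply/pint_gt0.
  by move=> /lt_le_trans/(_ (xf 0%N t)); rewrite pmulr_rgt0.
have small e : 0 < e -> \forall k \near \oo, a * q ^+ k <= e.
  move=> e0; have e1 : (1 : R) < 1 + e by rewrite ltrDl.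
  have ub : \forall k \near \oo, 1 + a * q ^+ k <= 1 + e.
    exact: (cvgr_le _ (cvg_geometric_to1 a q0 q1)).
  by apply: filterS ub => k; rewrite lerD2l.
have fcont : continuous f.
  apply: uniform_approx_continuous => e e0.
  have z1 : 0 < `|z| + 1 by rewrite ltr_wpDl.
  have [k ke] := filter_ex (small _ (divr_gt0 e0 z1)).
  exists (x k) => t; rewrite ler0_norm ?subr_le0// opprB.
  have fz : f t <= `|z| + 1.
    rewrite (le_trans (fx 0%N t))// (le_trans (ler_norm _))//.
    by rewrite (le_trans (supnorm_ge (x 0%N) t))// lerDl.
  have := ler_pM (aq k) (ltW (f0 t)) ke fz; rewrite divfK ?gt_eqF// => aqf.
  by have := xf k t; lra.
pose xb : C := mkcspace fcont.
have xbP : pint xb by apply/pint_gt0.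
exists xb => //; apply/cspaceP => t; apply/eqP; rewrite eq_le; apply/andP;
  split.
  apply: lb_le_inf; first exact: (hasinf t).1.
  move=> _ [k _ <-]; apply: (le_trans _ (xS k t)).
  by apply: Fmono => // u; exact: fx.
(* Conversely xb <= x_{k+1} = F x_k <= F ((1 + a q^k) xb) <= (1 + a q^k) F xb, and the excess is at
   most [e] for a suitable [k]. *)
apply/ler_addgt0Pr => e e0.
have Fx0 : 0 < F xb t by move: t; apply/pint_gt0/Fpint.
have [k ke] := filter_ex (small _ (divr_gt0 e0 Fx0)).
rewrite (le_trans (fx k.+1 t))//.
have := Fmono (xP k) (pintZ (aq1 k) xbP) (xf k) t.
move=> /le_trans; apply.
have c1 : 1 <= 1 + a * q ^+ k by rewrite lerDl.
apply: le_trans (FZ c1 xbP t) _; rewrite !(cspaceDE, cspaceZE, cspaceNE).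
have := ler_wpM2r (ltW Fx0) ke; rewrite divfK ?gt_eqF// => h.
have : 0 <= a * q ^+ k * b t by rewrite mulr_ge0//; exact: (pint_pcone bP t).
by lra.
Qed.

(** The contraction is applied in both directions. Two-sided ratios, unlike one-sided bounds, are
    insensitive to the order reversal of a negative power. *)
Lemma iter_ratio_cvg x y : pint x -> pint y -> F y = y ->
  exists c : nat -> R, [/\ forall k, 1 <= c k, c @ \oo --> (1 : R) &
    forall k, cle (iter k F x) (c k *: y) /\ cle y (c k *: iter k F x)].
Proof.
move=> xP yP Fy.
have [a a0 xa] := pint_dom x wP; have [a' a'0 ya'] := pint_dom y wP.
(* Large enough for both [x] and [y] to lie below [M *: w]. *)
pose M := M0 + a + a'; have M0M : M0 <= M by rewrite /M; lra.
have aM : a <= M by rewrite /M; move: M0_gt0; lra.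
have a'M : a' <= M by rewrite /M; move: M0_gt0; lra.
have bnd c z : c <= M -> cle z (c *: w) -> cle z (M *: w).
  move=> cM zc t; rewrite (le_trans (zc t))// !cspaceZE ler_wpM2r//.
  exact: (pint_pcone wP t).
have xM : cle x (M *: w) by exact: (bnd _ _ aM xa).
have yM : cle y (M *: w) by exact: (bnd _ _ a'M ya').
have [q /andP[q0 q1] contr] := iter_contraction M0M.
have [d d0 xd] := pint_dom x yP; have [d' d'0 yd'] := pint_dom y xP.
have step e z1 z2 : 0 < e -> pint z2 -> e <= d + d' -> cle z1 (e *: z2) ->
    cle z1 ((1 + (d + d')) *: z2).
  move=> e0 z2P ed z12 t; rewrite (le_trans (z12 t))// !cspaceZE ler_wpM2r//.
    exact: (pint_pcone z2P t).
  by rewrite (le_trans ed)// lerDr.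
have xy : cle x ((1 + (d + d')) *: y) by apply: step xd => //;
  rewrite lerDl ltW.
have yx : cle y ((1 + (d + d')) *: x) by apply: step yd' => //;
  rewrite lerDr ltW.
have dd : 0 <= d + d' by rewrite addr_ge0 ?ltW.
have Fky k : iter k F y = y by elim: k => //= k ->.
exists (fun k => 1 + (d + d') * q ^+ k); split.
- by move=> k; rewrite lerDl mulr_ge0// exprn_ge0.
- exact: cvg_geometric_to1.
- move=> k; have := contr _ _ _ dd xP yP yM xy k.
  by have := contr _ _ _ dd yP xP xM yx k; rewrite Fky.
Qed.

End MonotoneContraction.

(** * The power substitution and transfer to [Gmap] *)

Section PowerConjugate.
Context {R : realType} {T : topologicalType} {cT : compact [set: T]}.
Local Notation C := (cspace R cT).
Context (A : {linear C -> C}) (b : C) (s : R).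
Context (Apos : positive_op A) (Apint : set_fun pint pint A).
Context (bP : pint b) (s0 : s != 0).
Implicit Types (x y w : C) (c p : R).

Lemma cpow_le_gt0 p x y : 0 < p -> pint x -> pint y -> cle x y ->
  cle (cpow x p) (cpow y p).
Proof.
move=> p0 xP yP xy t; rewrite !cpowE// ler_powR_gt0//;
  by [exact: xy|move: t; apply/pint_gt0].
Qed.

Lemma cpow_le_lt0 p x y : p < 0 -> pint x -> pint y -> cle x y ->
  cle (cpow y p) (cpow x p).
Proof.
move=> p0 xP yP xy t; rewrite !cpowE// ler_powR_lt0//;
  by [exact: xy|move: t; apply/pint_gt0].
Qed.

Lemma cpowZ p c x : 0 < c -> pint x -> cpow (c *: x) p = c `^ p *: cpow x p.
Proof.
move=> c0 xP; apply/cspaceP => t.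
rewrite cspaceZE !cpowE//; last exact: pintZ.
by rewrite powRM ?(ltW c0)//; exact: (pint_pcone xP t).
Qed.

Lemma cpowK p x : p != 0 -> pint x -> cpow (cpow x p) p^-1 = x.
Proof.
move=> p0 xP; apply/cspaceP => t; rewrite !cpowE//; last exact: cpow_pint.
by rewrite powRK//; exact: (pint_pcone xP t).
Qed.

Lemma cpowVK p x : p != 0 -> pint x -> cpow (cpow x p^-1) p = x.
Proof.
by move=> p0 xP; rewrite -{2}(invrK p) cpowK// invr_eq0.
Qed.

Definition Hmap x : C := cpow (A (cpow x s)) s^-1.
Definition Fmap x : C := Hmap x + b.

Lemma FmapE x t : Fmap x t = Hmap x t + b t.
Proof. by []. Qed.

Lemma Hmap_pint : set_fun pint pint Hmap.
Proof. by move=> x xP; apply/cpow_pint/Apint/cpow_pint. Qed.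

Lemma Fmap_pint : set_fun pint pint Fmap.
Proof. by move=> x xP; apply: pintD => //; exact: Hmap_pint. Qed.

(** For negative [s] both powers reverse the order, and the two reversals cancel. *)
Lemma Hmap_le x y : pint x -> pint y -> cle x y -> cle (Hmap x) (Hmap y).
Proof.
move=> xP yP xy; have [xs ys] := (cpow_pint s xP, cpow_pint s yP).
have [sgt|slt|/eqP] := ltgtP s 0; last by rewrite (negPf s0).
  apply: cpow_le_lt0; rewrite ?invr_lt0//; try exact: Apint.
  by apply: positive_le => //; exact: cpow_le_lt0.
apply: cpow_le_gt0; rewrite ?invr_gt0//; try exact: Apint.
by apply: positive_le => //; exact: cpow_le_gt0.
Qed.

Lemma HmapZ c x : 0 < c -> pint x -> Hmap (c *: x) = c *: Hmap x.
Proof.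
move=> c0 xP; rewrite /Hmap cpowZ// linearZ cpowZ ?powR_gt0//.
  by rewrite powRK// ltW.
by apply/Apint/cpow_pint.
Qed.

(** Conjugacy by the power [s]: the inner powers cancel, and [Gmap] at [cpow x s] unfolds to
    [cpow (Fmap x) s]. *)
Lemma Gmap_iter k y : pint y ->
  iter k (Gmap A b s) y = cpow (iter k Fmap (cpow y s^-1)) s.
Proof.
move=> yP; have xP := cpow_pint s^-1 yP.
elim: k => [|k IH]; first by rewrite /= cpowVK.
by rewrite !iterS IH.
Qed.

(** For [s < 0] the hypothesis reads r(A) > 1, and the power 1/s turns a subsolution with l > 1 into
    a supersolution with l^(1/s) < 1. For [s > 0] a supersolution with l < 1 is used directly. *)
Lemma exists_Hmap_supersol : [set: T] !=set0 -> irreducible_op A ->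
  eventually_compact A -> spectral_radius A `^ s < 1 ->
  exists2 rho, rho < 1 & exists2 w, pint w & cle (Hmap w) (rho *: w).
Proof.
move=> T0 Airr Acpt; set r := spectral_radius A.
have r0 : 0 < r by exact: spectral_radius_gt0.
have [slt|sgt|/eqP] := ltgtP s 0; last by rewrite (negPf s0).
- rewrite powR_lt1_lt0// => r1; pose l := (1 + r) / 2.
  have l1 : 1 < l by rewrite /l; lra.
  have lr : l < r by rewrite /l; lra.
  have l0 : 0 < l by lra.
  have [w wP Aw] := subsolution T0 Apos Apint Airr Acpt l0 lr.
  exists (l `^ s^-1).
    by rewrite powR_lt1_lt0// invr_lt0.
  exists (cpow w s^-1); first exact: cpow_pint.
  rewrite /Hmap cpowVK// -cpowZ//; apply: cpow_le_lt0 => //.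
  + by rewrite invr_lt0.
  + exact: pintZ.
  + exact: Apint.
rewrite powR_lt1_gt0// => r1; pose l := (1 + r) / 2.
have l1 : l < 1 by rewrite /l; lra.
have rl : r < l by rewrite /l; lra.
have l0 : 0 < l by lra.
have [w wP Aw] := supersolution T0 Apos Apint rl.
exists (l `^ s^-1).
  by rewrite powR_lt1_gt0// invr_gt0.
exists (cpow w s^-1); first exact: cpow_pint.
rewrite /Hmap cpowVK// -cpowZ//; apply: cpow_le_gt0 => //.
+ by rewrite invr_gt0.
+ exact: Apint.
+ exact: pintZ.
Qed.

(** For either sign of [s], the powers of [x] and [y] have mutual ratios at most d = c^|s|. *)
Lemma norm_cpow_ratio c x y : 1 <= c -> pint x -> pint y ->
  cle x (c *: y) -> cle y (c *: x) ->
  `|cpow x s - cpow y s| <= (c `^ `|s| - 1) * `|cpow y s|.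
Proof.
move=> c1 xP yP xy yx; have c0 : 0 < c by exact: lt_le_trans c1.
set d := c `^ `|s|; have d1 : 1 <= d.
  by rewrite -(powRr0 c) ler_powR.
have d0 : 0 < d by exact: lt_le_trans d1.
apply: supnorm_le => [|t]; first by rewrite mulr_ge0 ?subr_ge0.
have [yt ds] : 0 <= cpow y s t /\
    (cpow x s t <= d * cpow y s t /\ cpow y s t <= d * cpow x s t).
  split; first exact: (pint_pcone (cpow_pint s yP) t).
  have [slt|sgt|/eqP] := ltgtP s 0; last by rewrite (negPf s0).
    have dE : d = (c `^ s)^-1 by rewrite /d ltr0_norm// powRN.
    have := cpow_le_lt0 slt xP (pintZ c0 yP) xy t.
    have := cpow_le_lt0 slt yP (pintZ c0 xP) yx t.
    by rewrite !cpowZ// !cspaceZE dE !ler_pdivlMl ?powR_gt0.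
  have dE : d = c `^ s by rewrite /d gtr0_norm.
  have := cpow_le_gt0 sgt xP (pintZ c0 yP) xy t.
  have := cpow_le_gt0 sgt yP (pintZ c0 xP) yx t.
  by rewrite !cpowZ// !cspaceZE dE.
have yn : cpow y s t <= `|cpow y s|.
  by rewrite (le_trans (ler_norm _))// supnorm_ge.
have dm : 0 <= d - 1 by rewrite subr_ge0.
apply: le_trans (_ : (d - 1) * cpow y s t <= _); last by rewrite ler_wpM2l.
rewrite cspaceBE ler_norml; case: ds => h1 h2; apply/andP; split; last by lra.
(* This is (d - 1)^2 >= 0; it bounds 1/d below by 2 - d, which gives the lower half of the
   estimate. *)
have : (1 - (d - 1)) * d <= 1.
  by have := mulr_ge0 dm dm; lra.
move=> /(ler_wpM2r yt) h3.
have : d * ((1 - (d - 1)) * cpow y s t) <= d * cpow x s t by lra.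
by rewrite ler_pM2l//; lra.
Qed.

Lemma Gmap_stable : [set: T] !=set0 -> irreducible_op A ->
  eventually_compact A -> spectral_radius A `^ s < 1 ->
  globally_stable pint (Gmap A b s).
Proof.
move=> T0 Airr Acpt /(exists_Hmap_supersol T0 Airr Acpt)[rho rho1 [w wP Hw]].
have [D D0 bD] := pint_dom b wP.
(* Threshold beyond which [rho * M + D <= M], so that [M *: w] is a supersolution of [Fmap]. *)
pose M0 := D / (1 - rho); have M00 : 0 < M0 by rewrite divr_gt0// subr_gt0.
have Fmono x y : pint x -> pint y -> cle x y -> cle (Fmap x) (Fmap y).
  move=> xP yP xy t.
  exact (lerD (Hmap_le xP yP xy t) (lexx (b t))).
have Fb x : pint x -> cle b (Fmap x).
  by move=> /Hmap_pint xP t; rewrite FmapE lerDr; exact: (pint_pcone xP t).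
have FZ c x : 1 <= c -> pint x ->
    cle (Fmap (c *: x)) (c *: Fmap x - (c - 1) *: b).
  move=> c1 xP t; rewrite FmapE HmapZ ?(lt_le_trans _ c1)//.
  rewrite cspaceBE 3!cspaceZE FmapE.
  by move: (Hmap x t) => h; lra.
have Fw M : M0 <= M -> cle (Fmap (M *: w)) (M *: w).
  move=> MM t; have M1 : 0 < M by exact: lt_le_trans MM.
  rewrite FmapE HmapZ// 2!cspaceZE.
  have wt : 0 <= w t := pint_pcone wP t.
  have h1 := ler_wpM2l (ltW M1) (Hw t); rewrite cspaceZE in h1.
  have h2 : b t <= D * w t := bD t.
  have : D <= M * (1 - rho) by rewrite -ler_pdivrMr// subr_gt0.
  by move=> /(ler_wpM2r wt); lra.
have [x xP Fx] := exists_fixed_point Fmap_pint bP wP Fmono Fb FZ M00 Fw.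
have cvgG y : pint y ->
    (fun k : nat => `|iter k (Gmap A b s) y - cpow x s|) @ \oo --> (0 : R).
  move=> yP; have yP' := cpow_pint s^-1 yP.
  have [c [c1 cvgc cxy]] := iter_ratio_cvg Fmap_pint bP wP Fmono FZ M00 Fw yP'
    xP Fx.
  apply: (@squeeze_cvgr _ _ _ _ (fun=> 0)
    (fun k => (c k `^ `|s| - 1) * `|cpow x s|)); last 2 first.
  - exact: cvg_cst.
  - rewrite -(mul0r `|cpow x s|) -(subrr (1 : R)).
    apply: cvgMl; apply: cvgB; last exact: cvg_cst.
    exact: cvg_powR_to1.
  near=> k; rewrite normr_ge0/= Gmap_iter//.
  have [xy yx] := cxy k; apply: norm_cpow_ratio => //.
  by apply: iter_pint => //; exact: Fmap_pint.
split; first exact: Gmap_pint.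
have Gx : Gmap A b s (cpow x s) = cpow x s.
  by rewrite -[LHS]/(iter 1 _ _) Gmap_iter ?cpowK//= ?Fx//; exact: cpow_pint.
exists (cpow x s); split => //.
- by split => //; exact: cpow_pint.
(* Uniqueness comes from convergence: the orbit of a fixed point is constant. *)
- move=> y yP Gy; have := cvgG y yP.
  have Gky k : iter k (Gmap A b s) y = y.
    by elim: k => [//|k IH]; rewrite iterS IH Gy.
  rewrite (_ : (fun k => _) = (fun=> `|y - cpow x s|)); last first.
    by apply/funext => k; rewrite Gky.
  move: (cpow x s) => z /(cvg_lim (@Rhausdorff R)).
  by rewrite lim_cst// => /eqP; rewrite normr_eq0 subr_eq0 => /eqP.
Unshelve. all: by end_near. Qed.

(** At a fixed point (Ay)^(1/s) = y^(1/s) - b, and [b] exceeds a fixed fraction of y^(1/s). Raising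
    to the power [s] leaves a strict Collatz-Wielandt inequality for [y]. *)
Lemma fixed_point_spectral_radius y : [set: T] !=set0 ->
  pint y -> Gmap A b s y = y -> spectral_radius A `^ s < 1.
Proof.
move=> T0 yP Gy; have AyP := Apint yP.
have [D D0 yD] := pint_dom (cpow y s^-1) bP.
have D1 : 0 < D + 1 by rewrite ltr_wpDl// ltW.
pose k := 1 - (D + 1)^-1.
have k1 : k < 1 by rewrite ltrBlDr ltrDl invr_gt0.
have k0 : 0 < k by rewrite subr_gt0 invf_lt1// ltrDr.
have r0 : 0 < spectral_radius A by exact: spectral_radius_gt0.
have Ay : cle (cpow (A y) s^-1) (k *: cpow y s^-1).
  move=> t; have : cpow y s^-1 = cpow (A y) s^-1 + b.
    by rewrite -{1}Gy cpowK//; apply: pintD => //; exact: cpow_pint.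
  move=> /(congr1 (fun z : C => z t)); rewrite cspaceDE cspaceZE => yE.
  have : (D + 1)^-1 * cpow y s^-1 t <= b t.
    rewrite ler_pdivrMl//; have := yD t; rewrite cspaceZE.
    have : 0 < b t by move: t {yE}; apply/pint_gt0.
    by lra.
  by rewrite /k; lra.
have kyP : pint (k *: cpow y s^-1) by apply: pintZ => //; exact: cpow_pint.
have AsP := cpow_pint s^-1 AyP.
have ks0 : 0 < k `^ s by exact: powR_gt0.
have [slt|sgt|/eqP] := ltgtP s 0; last by rewrite (negPf s0).
  rewrite powR_lt1_lt0//.
  have := cpow_le_lt0 slt AsP kyP Ay; rewrite cpowZ ?cpowVK//;
    last exact: cpow_pint.
  move=> /(spectral_radius_ge T0 Apos Apint ks0 yP); apply: lt_le_trans.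
  by rewrite powR_gt1_lt0.
rewrite powR_lt1_gt0//.
have := cpow_le_gt0 sgt AsP kyP Ay; rewrite cpowZ ?cpowVK//;
  last exact: cpow_pint.
move=> /(spectral_radius_le T0 Apos Apint ks0 yP)/le_lt_trans; apply.
by rewrite powR_lt1_gt0.
Qed.

End PowerConjugate.

Theorem theorem3p1 (R : realType) (T : topologicalType)
    (cT : compact [set: T]) (hT : hausdorff_space T) (T0 : [set: T] !=set0)
    (A : {linear cspace R cT -> cspace R cT}) (b : cspace R cT) (s : R)
    (A_neq0 : exists x, A x <> 0) (A_pos : positive_op A)
    (b_gg0 : cll 0 b) (s_neq0 : s <> 0)
    (A_irr : irreducible_op A) (A_cpt : eventually_compact A) :
  (spectral_radius A `^ s < 1 <-> globally_stable pint (Gmap A b s)) /\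
  (1 <= spectral_radius A `^ s ->
     ~ exists y : cspace R cT, pint y /\ Gmap A b s y = y).
Proof.
(* Irreducibility makes [A] preserve the interior of the cone, where all the powers are taken. *)
have Apint := irreducible_pint hT A_neq0 A_pos A_irr.
have s0 : s != 0 by exact/eqP.
have bP : pint b by move: b_gg0; rewrite /cll subr0.
split; first split.
- exact: Gmap_stable.
- move=> [_ [y [[yP Gy] _ _]]].
  exact: (fixed_point_spectral_radius A_pos Apint bP s0 T0 yP Gy).
- move=> r1 [y [yP Gy]].
  have := fixed_point_spectral_radius A_pos Apint bP s0 T0 yP Gy.
  by rewrite ltNge r1.
Qed.
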